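(* Let $\Pi$ be a finite set of miners with mining powers $m_p>0$ ($p\in\Pi$), let $C$ be a finite nonempty set of coins, and let $F:C\to\mathbb{R}_+$ be a reward function. Then the function $H:S\to\mathbb{R}$, $H(s)=\mathrm{rank}(\mathrm{list}(s))$, is an ordinal potential in the game $G_{\Pi,C,F}$; that is, for all configurations $s,s'\in S$ such that some better response step of some miner $p\in\Pi$ leads from $s$ to $s'$, we have $H(s)<H(s')$.
   Context: The game $G_{\Pi,C,F}$: $\Pi$ is a finite set of $n$ miners, miner $p$ has mining power $m_p\in\mathbb{R}_+$; $C$ is a finite nonempty set of coins; $F:C\to\mathbb{R}_+$ assigns a reward to each coin ($\mathbb{R}_+$ denotes the positive reals). A configuration is an assignment of a coin to every miner; $S=C^n$ is the set of configurations and $s.p\in C$ is the coin chosen by $p$ in $s$. For $c\in C$, $P_c(s)=\{p\in\Pi: s.p=c\}$ and $M_c(s)=\sum_{p\in P_c(s)}m_p$. The revenue per unit of $c$ in $s$ is $RPU_c(s)=F(c)/M_c(s)$, with the convention $RPU_c(s)=+\infty$ if $M_c(s)=0$. The payoff of miner $p$ is $u_p(s)=m_p\cdot F(s.p)/M_{s.p}(s)$. The configuration $(s_{-p},c)$ is identical to $s$ except that $p$ chooses $c$. The move of $p$ from $s.p$ to $c$ is a better response step, leading from $s$ to $(s_{-p},c)$, if $u_p(s)<u_p((s_{-p},c))$. Fix a total order on $C$. For $s\in S$, $\mathrm{list}(s)$ is the sequence (of length $|C|$) of the pairs $\langle RPU_c(s),c\rangle$, $c\in C$, arranged in increasing lexicographic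 order of pairs. Let $L=\{\mathrm{list}(s): s\in S\}$, a finite set, totally ordered by the lexicographic order $\prec_L$ on sequences of pairs (the pairs themselves being compared lexicographically). The rank $\mathrm{rank}(\ell)$ of $\ell\in L$ is its position in $L$ with respect to $\prec_L$, counted from smallest to largest. *)

(* Defs.v *)
From mathcomp Require Import all_boot all_order all_algebra.
From mathcomp Require Import constructive_ereal reals.

Set Implicit Arguments.
Unset Strict Implicit.
Unset Printing Implicit Defensive.

Import Order.TTheory GRing.Theory Num.Theory.

Local Open Scope ring_scope.

Definition config (Pi C : finType) := {ffun Pi -> C}.

Definition miners_on (Pi C : finType) (c : C) (s : config Pi C) : {set Pi} :=
  [set p | s p == c].

Definition coin_power (R : realType) (Pi C : finType) (m : Pi -> R)
    (c : C) (s : config Pi C) : R :=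
  \sum_(p in miners_on c s) m p.

Definition RPU (R : realType) (Pi C : finType) (m : Pi -> R) (F : C -> R)
    (c : C) (s : config Pi C) : \bar R :=
  if coin_power m c s == 0 then +oo%E else (F c / coin_power m c s)%:E.

Definition payoff (R : realType) (Pi C : finType) (m : Pi -> R) (F : C -> R)
    (p : Pi) (s : config Pi C) : R :=
  m p * F (s p) / coin_power m (s p) s.

(* The configuration (s_{-p}, c). *)
Definition deviate (Pi C : finType) (s : config Pi C) (p : Pi) (c : C) :
    config Pi C :=
  [ffun q => if q == p then c else s q].

Definition better_response_step (R : realType) (Pi C : finType)
    (m : Pi -> R) (F : C -> R) (p : Pi) (s s' : config Pi C) : Prop :=
  exists c : C,
    s' = deviate s p c /\ payoff m F p s < payoff m F p (deviate s p c).

Definition ordinal_potential (R : realType) (Pi C : finType)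
    (m : Pi -> R) (F : C -> R) (H : config Pi C -> R) : Prop :=
  forall s s' : config Pi C,
    (exists p : Pi, better_response_step m F p s s') -> H s < H s'.

(* The aliases *l and seqlexi select the lexicographic orders on pairs and on
   sequences of pairs; C carries its given total order. *)
Definition rpu_pair (R : realType) (d : Order.disp_t) (C : finOrderType d) :=
  (\bar R *l C)%type.

Definition rpu_seq (R : realType) (d : Order.disp_t) (C : finOrderType d) :=
  seqlexi (rpu_pair R C).

Definition rpu_list (R : realType) (Pi : finType) (d : Order.disp_t)
    (C : finOrderType d) (m : Pi -> R) (F : C -> R) (s : config Pi C) :
    rpu_seq R C :=
  sort <=%O [seq ((RPU m F c s, c) : rpu_pair R C) | c <- enum C].

(* The finite set L, as its strictly increasing enumeration. *)
Definition all_lists (R : realType) (Pi : finType) (d : Order.disp_t)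
    (C : finOrderType d) (m : Pi -> R) (F : C -> R) : seq (rpu_seq R C) :=
  sort <=%O (undup [seq rpu_list m F s | s <- enum {: config Pi C}]).

(* Positions are counted from 1. *)
Definition rank (R : realType) (Pi : finType) (d : Order.disp_t)
    (C : finOrderType d) (m : Pi -> R) (F : C -> R) (l : rpu_seq R C) : nat :=
  (index l (all_lists m F)).+1.

(* Main.v *)
Require Import Defs.
From mathcomp Require Import all_boot all_order all_algebra.
From mathcomp Require Import constructive_ereal reals.

(** When [p] moves from coin [a] to coin [b] with a gain, the revenue per unit
    of [a] before the move is strictly below each of the three other revenues
    per unit involved: that of [b] after the move (this is the gain), that of
    [b] before the move (more power on [b] only lowers it) and that of [a] after
    the move (power has left [a]).  All other coins are unaffected.  Hence the
    pair of [a] disappears from the list, while the pairs smaller than it are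
    the same before and after, so that the list increases lexicographically. *)

Import Order.TTheory GRing.Theory Num.Theory.

Local Open Scope ring_scope.

Section SeqLexi.
Context {d : Order.disp_t} {T : orderType d}.
Implicit Types (s t : seq T) (x y : T).

(** Below [x] both sorted lists have the same entries, and then [s] has more copies of [x]. So at
    the first difference [s] holds [x] and [t] something larger. *)
Lemma sorted_seqlexi_lt s t x :
    sorted <=%O s -> sorted <=%O t -> size s = size t ->
    (forall y, (y < x)%O -> count_mem y s = count_mem y t) ->
    (count_mem x t < count_mem x s)%N ->
  ((s : seqlexi T) < (t : seqlexi T))%O.
Proof.
elim: s t => [|h s IHs] [|k t] //= hs kt [eq_size] eq_count lt_count.
rewrite ltxi_cons; case: (ltgtP h k) => //= [lt_kh | eq_hk]; last first.
  subst k; apply: IHs => //.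
  - exact: path_sorted hs.
  - exact: path_sorted kt.
  - by move=> y /eq_count /addnI.
  - by rewrite ltn_add2l in lt_count.
(* Here [k < h], and [h] is least in [h :: s], so nothing below [h] occurs there. If [k < x] this
   contradicts [eq_count] at [k]; otherwise [x <= k < h] and [x] is absent too, against
   [lt_count]. *)
have h_lb y : (y < h)%O -> ((h == y) + count_mem y s)%N = 0%N.
  move=> lt_yh; rewrite gt_eqF //=; apply/count_memPn/negP => y_s.
  by have /allP/(_ y y_s) := order_path_min le_trans hs; rewrite leNgt lt_yh.
have [lt_kx | le_xk] := ltP k x.
  by have := eq_count k lt_kx; rewrite eqxx h_lb.
by rewrite (h_lb x (le_lt_trans le_xk lt_kh)) in lt_count.
Qed.

Lemma sorted_index_lt s x y :
  sorted <=%O s -> x \in s -> y \in s -> (x < y)%O -> (index x s < index y s)%N.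
Proof.
move=> s_sorted xs ys; apply: contraTT; rewrite -leqNgt -leNgt.
exact: (sorted_leq_index le_trans lexx s_sorted).
Qed.

End SeqLexi.

Section Game.
Context {R : realType} {Pi : finType}.
Variables (m : Pi -> R).
Hypothesis m_gt0 : forall p, 0 < m p.

Section UnorderedCoins.
Context {C : finType}.
Variable F : C -> R.
Hypothesis F_gt0 : forall c, 0 < F c.
Implicit Types (s t : config Pi C) (p : Pi) (a b c : C).

Lemma coin_power_ge0 c s : 0 <= coin_power m c s.
Proof. by apply: sumr_ge0 => p _; apply: ltW. Qed.

Lemma coin_power_gt0 p s : 0 < coin_power m (s p) s.
Proof.
rewrite /coin_power (bigD1 p) ?inE //=.
by rewrite ltr_wpDr // sumr_ge0 // => q _; apply: ltW.
Qed.

Lemma coin_power_lt c s t :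
  miners_on c s \proper miners_on c t -> coin_power m c s < coin_power m c t.
Proof.
case/properP=> sub [p pt ps].
rewrite /coin_power [ltRHS](big_setID (miners_on c s)) /= (setIidPr sub) ltrDl.
rewrite (bigD1 p) ?inE /=; last by move: ps pt; rewrite !inE => -> ->.
by rewrite ltr_wpDr // sumr_ge0 // => q _; apply: ltW.
Qed.

Lemma RPU_lt c s t :
  coin_power m c t < coin_power m c s -> (RPU m F c s < RPU m F c t)%E.
Proof.
move=> lt_ts; have s_gt0 := le_lt_trans (coin_power_ge0 c t) lt_ts.
(* If [t] leaves [c] without power, its revenue per unit is [+oo], still strictly above the finite
   value at [s]. *)
rewrite /RPU (gt_eqF s_gt0); case: eqVneq => [_ | t_neq0]; first exact: ltry.
rewrite lte_fin ltr_pM2l // ltf_pV2 // posrE.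
by rewrite lt0r t_neq0 coin_power_ge0.
Qed.

Lemma RPU_occupied p s : RPU m F (s p) s = (F (s p) / coin_power m (s p) s)%:E.
Proof. by rewrite /RPU gt_eqF ?coin_power_gt0. Qed.

(** The coin that [p] mines has positive power, so its revenue per unit is finite, and the payoff is
    this value times [m p]. *)
Lemma RPU_lt_payoff p s t :
  (RPU m F (s p) s < RPU m F (t p) t)%E = (payoff m F p s < payoff m F p t).
Proof. by rewrite !RPU_occupied lte_fin /payoff -!mulrA ltr_pM2l. Qed.

Lemma deviate_id s p : deviate s p (s p) = s.
Proof. by apply/ffunP=> q; rewrite ffunE; case: eqP => // ->. Qed.

Lemma deviate_at s p b : deviate s p b p = b.
Proof. by rewrite ffunE eqxx. Qed.

Lemma RPU_deviate_other s p b c :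
  c != s p -> c != b -> RPU m F c (deviate s p b) = RPU m F c s.
Proof.
move=> c_sp c_b; rewrite /RPU /coin_power.
suff -> : miners_on c (deviate s p b) = miners_on c s by [].
apply/setP => q; rewrite !inE ffunE.
by case: (q =P p) => // ->; rewrite eq_sym (negPf c_b) eq_sym (negPf c_sp).
Qed.

Lemma miners_on_deviate_source s p b :
  b != s p -> miners_on (s p) (deviate s p b) \proper miners_on (s p) s.
Proof.
move=> b_sp; apply/properP; split; last first.
  by exists p; rewrite inE ?deviate_at.
by apply/subsetP => q; rewrite !inE ffunE; case: (q =P p) => // ->; rewrite eqxx.
Qed.

Lemma miners_on_deviate_target s p b :
  b != s p -> miners_on b s \proper miners_on b (deviate s p b).
Proof.
move=> b_sp; apply/properP; split; last first.
  by exists p; rewrite inE ?deviate_at // eq_sym.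
by apply/subsetP => q; rewrite !inE ffunE; case: (q =P p) => // ->; rewrite eqxx.
Qed.

End UnorderedCoins.

Section OrderedCoins.
Context {d : Order.disp_t} {C : finOrderType d}.
Variable F : C -> R.
Hypothesis F_gt0 : forall c, 0 < F c.
Implicit Types (s : config Pi C) (p : Pi) (b c : C).

Let pair_of s c : rpu_pair R C := (RPU m F c s, c).

Let pair_lt s t c e :
  (RPU m F c s < RPU m F e t)%E -> (pair_of s c < pair_of t e)%O.
Proof. by move=> lt_st; rewrite /pair_of ltxi_pair (ltW lt_st) (lt_geF lt_st). Qed.

Lemma rpu_list_lt s p b :
  payoff m F p s < payoff m F p (deviate s p b) ->
  (rpu_list m F s < rpu_list m F (deviate s p b))%O.
Proof.
move=> gain; have b_sp : b != s p.
  by apply: contraTneq gain => ->; rewrite deviate_id ltxx.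
set s' := deviate s p b in gain *; set x := pair_of s (s p).
have x_b' : (x < pair_of s' b)%O.
  by apply: pair_lt; move: gain; rewrite -RPU_lt_payoff // deviate_at.
have x_b : (x < pair_of s b)%O.
  apply: (lt_trans x_b'); apply: pair_lt.
  exact/RPU_lt/coin_power_lt/miners_on_deviate_target.
have x_a' : (x < pair_of s' (s p))%O.
  exact/pair_lt/RPU_lt/coin_power_lt/miners_on_deviate_source.
have same c : c != s p -> c != b -> pair_of s' c = pair_of s c.
  by move=> c_sp c_b; rewrite /pair_of RPU_deviate_other.
apply: (@sorted_seqlexi_lt _ _ _ _ x).
- exact: (sort_sorted le_total).
- exact: (sort_sorted le_total).
- by rewrite !size_sort !size_map.
- move=> y lt_yx; rewrite !count_sort !count_map; apply: eq_count => c /=.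
  (* The pairs of [s p] and [b] exceed or equal [x] both before and after the move, so they never
     equal [y]. *)
  rewrite -/(pair_of s c) -/(pair_of s' c).
  have [->|c_sp] := eqVneq c (s p).
    by rewrite !gt_eqF // (lt_trans lt_yx).
  have [->|c_b] := eqVneq c b; first by rewrite !gt_eqF // (lt_trans lt_yx).
  by rewrite same.
(* In the new list [x] could only come from its own coin [s p], whose pair is now strictly larger;
   in the old list it occurs. *)
rewrite !count_sort (count_memPn _) -?has_count; last first.
  apply/negP => /mapP[c _ x_c]; move: (x_a').
  by rewrite (_ : s p = c) -?[pair_of s' c]x_c ?ltxx //; case: x_c.
by apply/hasP; exists x; rewrite /= ?eqxx //; apply/map_f; rewrite mem_enum.
Qed.

Lemma mem_all_lists s : rpu_list m F s \in all_lists (Pi := Pi) m F.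
Proof. by rewrite mem_sort mem_undup map_f ?mem_enum. Qed.

End OrderedCoins.

End Game.

Theorem theorem1 (R : realType) (Pi : finType) (d : Order.disp_t)
    (C : finOrderType d) (m : Pi -> R) (F : C -> R)
    (C_nonempty : (0 < #|C|)%N)
    (m_gt0 : forall p : Pi, 0 < m p) (F_gt0 : forall c : C, 0 < F c) :
  ordinal_potential m F
    (fun s : config Pi C => (rank m F (rpu_list m F s))%:R).
Proof.
(* The cast and the shift by one preserve strict order, which leaves a comparison of indices. *)
move=> s _ [p [b [-> gain]]]; rewrite ltr_nat ltnS.
apply: sorted_index_lt; [|exact: mem_all_lists|exact: mem_all_lists|].
  exact: (sort_sorted le_total).
exact: rpu_list_lt.
Qed.
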